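(* Let $\mu_{\mathbf X}$ and $\mu_{\mathbf Y}$ be Borel probability measures on $\mathbb{R}^n$ and $\mathbb{R}^m$ and let $\mu_{\mathbf U,\mathbf F}$ be a Borel probability measure on $\mathbb{R}^{n}\times\mathbb{R}^m$. Let $S:\mathbb{R}^{n+m}\to\mathbb{R}^{n+m}$ be a Reversible Simulator with inverse $R$ for the reference measures $\mu_{\mathbf X},\mu_{\mathbf Y}$ and target measure $\mu_{\mathbf U,\mathbf F}$. Let $P=(P_1,I_m)$ and $Q=(I_n,Q_2)$, i.e. $P(\mathbf x,\mathbf f)=(P_1(\mathbf x,\mathbf f),\mathbf f)$ and $Q(\mathbf u,\mathbf y)=(\mathbf u,Q_2(\mathbf u,\mathbf y))$, be invertible maps of $\mathbb{R}^{n+m}$ onto itself that are measure-preserving in the sense that $$P_1(\cdot,\mathbf f)_\#\mu_{\mathbf X}=\mu_{\mathbf X},\qquad Q_2(\mathbf u,\cdot)_\#\mu_{\mathbf Y}=\mu_{\mathbf Y}\qquad\text{for all }\mathbf f\in\mathbb{R}^m,\ \mathbf u\in\mathbb{R}^n.$$ Then $S'=P^{-1}\circ S\circ Q$, with inverse $R'=Q^{-1}\circ R\circ P$, is also a Reversible Simulator for the reference measures $\mu_{\mathbf X},\mu_{\mathbf Y}$ and target measure $\mu_{\mathbf U,\mathbf F}$.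
   Context: Points of $\mathbb{R}^{n+m}=\mathbb{R}^n\times\mathbb{R}^m$ are written as pairs with first component in $\mathbb{R}^n$ and second in $\mathbb{R}^m$; maps into $\mathbb{R}^{n+m}$ are split accordingly as $S=(S_1,S_2)$. All maps are Borel with Borel inverses. $T_\#\mu=\mu\circ T^{-1}$ is the push-forward, $\otimes$ the product measure. $\mu_{\mathbf U}$ and $\mu_{\mathbf F}$ denote the marginals of $\mu_{\mathbf U,\mathbf F}$ on $\mathbb{R}^n$ and $\mathbb{R}^m$. $\mu_{\mathbf F|\mathbf U=\mathbf u}$ and $\mu_{\mathbf U|\mathbf F=\mathbf f}$ denote the conditional measures (disintegrations) of $\mu_{\mathbf U,\mathbf F}$ with respect to $\mu_{\mathbf U}$ and $\mu_{\mathbf F}$. Since disintegrations are unique only up to null sets, an identity involving $\mu_{\mathbf F|\mathbf U=\mathbf u}$ (resp. $\mu_{\mathbf U|\mathbf F=\mathbf f}$) is understood for $\mu_{\mathbf U}$-a.e. $\mathbf u$ (resp. $\mu_{\mathbf F}$-a.e. $\mathbf f$). Reversible Simulator: an invertible map $S=(S_1,S_2):\mathbb{R}^{n+m}\to\mathbb{R}^{n+m}$ with inverse $R=(R_1,R_2)$ is a Reversible Simulator for reference measures $\mu_{\mathbf X},\mu_{\mathbf Y}$ and target measure $\mu_{\mathbf U,\mathbf F}$ if: (i) $(S_2(\mathbf u,\cdot))_\#\mu_{\mathbf Y}=\mu_{\mathbf F|\mathbf U=\mathbf u}$; (ii) $(R_1(\cdot,\mathbf f))_\#\mu_{\mathbf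 X}=\mu_{\mathbf U|\mathbf F=\mathbf f}$; (iii) $S_\#(\mu_{\mathbf U}\otimes\mu_{\mathbf Y})=\mu_{\mathbf X}\otimes\mu_{\mathbf F}$; (iv) $R_\#(\mu_{\mathbf X}\otimes\mu_{\mathbf F})=\mu_{\mathbf U}\otimes\mu_{\mathbf Y}$. *)

(* Defs.v *)
From HB Require Import structures.
From mathcomp Require Import all_boot all_order all_algebra.
From mathcomp Require Import all_classical all_reals all_analysis.

Set Implicit Arguments.
Unset Strict Implicit.
Unset Printing Implicit Defensive.

Import Order.TTheory GRing.Theory Num.Theory.
Import numFieldNormedType.Exports.

Local Open Scope classical_set_scope.
Local Open Scope ring_scope.
Local Open Scope ereal_scope.

(* R^n with its Borel sets: the sigma-algebra of [n.-tuple] is the product of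
   the Borel sigma-algebras of the coordinates, i.e. the one generated by the
   n coordinate projections. *)
Definition Rn (K : realType) (n : nat) : measurableType _ :=
  (n.-tuple (measurableTypeR K) : measurableType _).

Section marginals.
Context d1 d2 (T1 : measurableType d1) (T2 : measurableType d2).

HB.instance Definition _ :=
  isMeasurableFun.Build _ _ (T1 * T2)%type T1 fst measurable_fst.
HB.instance Definition _ :=
  isMeasurableFun.Build _ _ (T1 * T2)%type T2 snd measurable_snd.

Context (K : realType) (mu : probability (T1 * T2)%type K).

Definition marginal1 : probability T1 K := distribution mu fst.
Definition marginal2 : probability T2 K := distribution mu snd.

End marginals.

(* Measures are total on [set T] in the library and their values on
   non-measurable sets are irrelevant, whence the restriction. *)
Definition same_measure d (T : measurableType d) (K : realType)
    (m1 m2 : set T -> \bar K) : Prop :=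
  forall A : set T, measurable A -> m1 A = m2 A.

Definition borel_inverse d d' (T : measurableType d) (T' : measurableType d')
    (f : T -> T') (g : T' -> T) : Prop :=
  [/\ measurable_fun setT f, measurable_fun setT g, cancel f g & cancel g f].

Section reversible_simulator.
Context d1 d2 (T1 : measurableType d1) (T2 : measurableType d2) (K : realType).

(* [k u] is a version of the conditional law of the second coordinate given
   that the first one is u. *)
Definition disintegration1 (mu : probability (T1 * T2)%type K)
    (k : K.-pker T1 ~> T2) : Prop :=
  forall E : set (T1 * T2), measurable E ->
    mu E = \int[marginal1 mu]_u k u (xsection E u).

Definition disintegration2 (mu : probability (T1 * T2)%type K)
    (k : K.-pker T2 ~> T1) : Prop :=
  forall E : set (T1 * T2), measurable E ->
    mu E = \int[marginal2 mu]_f k f (ysection E f).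

(* [kF] and [kU] are the versions of the disintegrations of [muUF] that play
   the role of mu_{F|U=u} and mu_{U|F=f}. *)
Record reversible_simulator
    (muX : probability T1 K) (muY : probability T2 K)
    (muUF : probability (T1 * T2)%type K)
    (kF : K.-pker T1 ~> T2) (kU : K.-pker T2 ~> T1)
    (S R : T1 * T2 -> T1 * T2) : Prop := ReversibleSimulator {
  simulator_inverse : borel_inverse S R ;
  simulator_condF : {ae marginal1 muUF, forall u,
    same_measure (pushforward muY (fun y => (S (u, y)).2)) (kF u)} ;
  simulator_condU : {ae marginal2 muUF, forall f,
    same_measure (pushforward muX (fun x => (R (x, f)).1)) (kU f)} ;
  simulator_pushS : same_measure
    (pushforward (marginal1 muUF \x muY) S) (muX \x marginal2 muUF) ;
  simulator_pushR : same_measure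
    (pushforward (muX \x marginal2 muUF) R) (marginal1 muUF \x muY) }.

End reversible_simulator.

(* Main.v *)
(* P^-1 does not move the second coordinate, so S'_2(u, .) = S_2(u, .) o Q_2(u, .)
   and the inner map preserves mu_Y; symmetrically Q^-1 does not move the first
   one, so R'_1(., f) = R_1(., f) o P_1(., f). Integrating over the fixed
   coordinate, Q preserves mu_U (x) mu_Y and P preserves mu_X (x) mu_F, hence so
   do Q^-1 and P^-1, and (iii), (iv) follow by composing push-forwards. *)
Require Import Defs.
From HB Require Import structures.
From mathcomp Require Import all_boot all_order all_algebra.
From mathcomp Require Import all_classical all_reals all_analysis.

Set Implicit Arguments.
Unset Strict Implicit.
Unset Printing Implicit Defensive.

Import Order.TTheory GRing.Theory Num.Theory.
Import numFieldNormedType.Exports.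

Local Open Scope classical_set_scope.
Local Open Scope ring_scope.
Local Open Scope ereal_scope.

Section same_measure.
Context d d' (T : measurableType d) (T' : measurableType d') (K : realType).

Lemma same_measure_pushforward_comp d'' (T'' : measurableType d'')
    (f : T -> T') (g : T' -> T'') (m : set T -> \bar K) (m' : set T' -> \bar K)
    (m'' : set T'' -> \bar K) :
  measurable_fun setT g ->
  same_measure (pushforward m f) m' -> same_measure (pushforward m' g) m'' ->
  same_measure (pushforward m (g \o f)) m''.
Proof.
move=> mg fE gE A mA; rewrite -gE// -[RHS]fE//.
by rewrite -[_ @^-1` _]setTI; exact: mg.
Qed.

Lemma same_measure_pushforward_inv (f g : T -> T) (m : set T -> \bar K) :
  borel_inverse f g ->
  same_measure (pushforward m f) m -> same_measure (pushforward m g) m.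
Proof.
move=> [_ mg fK _] fE A mA; rewrite -[LHS]fE.
  by rewrite /pushforward -comp_preimage (_ : g \o f = id)//; apply/funext.
by rewrite -[_ @^-1` _]setTI; exact: mg.
Qed.

End same_measure.

Section product.
Context d1 d2 (T1 : measurableType d1) (T2 : measurableType d2) (K : realType).

(** Slicing along the first or along the second coordinate gives the same value on rectangles, and
    these determine a sigma-finite product. This allows [\x] to be computed by integrating over the
    second coordinate. *)
Lemma product_measure12 (m1 : {sigma_finite_measure set T1 -> \bar K})
    (m2 : {sigma_finite_measure set T2 -> \bar K}) :
  same_measure (m1 \x m2) (m1 \x^ m2).
Proof.
by apply: product_measure_unique => A B mA mB; exact: product_measure2E.
Qed.

Lemma same_measure_pushforward_fiber2 (m1 : {measure set T1 -> \bar K})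
    (m2 : {measure set T2 -> \bar K})
    (Q : T1 * T2 -> T1 * T2) (Q2 : T1 * T2 -> T2) :
  (forall u y, Q (u, y) = (u, Q2 (u, y))) ->
  (forall u, same_measure (pushforward m2 (fun y => Q2 (u, y))) m2) ->
  same_measure (pushforward (m1 \x m2) Q) (m1 \x m2).
Proof.
move=> QE Q2E A mA; apply: eq_integral => u _ /=.
rewrite -[RHS](Q2E u); last exact: measurable_xsection.
by congr (m2 _); apply/seteqP; split=> y; rewrite /= /xsection/= !inE/= QE.
Qed.

Lemma same_measure_pushforward_fiber1
    (m1 : {sigma_finite_measure set T1 -> \bar K})
    (m2 : {sigma_finite_measure set T2 -> \bar K})
    (P : T1 * T2 -> T1 * T2) (P1 : T1 * T2 -> T1) :
  measurable_fun setT P ->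
  (forall x f, P (x, f) = (P1 (x, f), f)) ->
  (forall f, same_measure (pushforward m1 (fun x => P1 (x, f))) m1) ->
  same_measure (pushforward (m1 \x m2) P) (m1 \x m2).
Proof.
move=> mP PE P1E A mA.
(* [\x] slices along the first coordinate while [P] acts inside the slices of the second. The switch
   to [\x^] is valid on measurable sets only, hence for this preimage too. *)
have mPA : measurable (P @^-1` A) by rewrite -[_ @^-1` _]setTI; exact: mP.
rewrite /pushforward !product_measure12//; apply: eq_integral => f _ /=.
rewrite -[RHS](P1E f); last exact: measurable_ysection.
by congr (m1 _); apply/seteqP; split=> x; rewrite /= /ysection/= !inE/= PE.
Qed.

Variables (muX : probability T1 K) (muY : probability T2 K)
  (muUF : probability (T1 * T2)%type K)
  (kF : K.-pker T1 ~> T2) (kU : K.-pker T2 ~> T1).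

Lemma reversible_simulator_comp (S R P Pinv Q Qinv : T1 * T2 -> T1 * T2)
    (P1 : T1 * T2 -> T1) (Q2 : T1 * T2 -> T2) :
  reversible_simulator muX muY muUF kF kU S R ->
  (forall x f, P (x, f) = (P1 (x, f), f)) ->
  (forall u y, Q (u, y) = (u, Q2 (u, y))) ->
  borel_inverse P Pinv ->
  borel_inverse Q Qinv ->
  (forall f, same_measure (pushforward muX (fun x => P1 (x, f))) muX) ->
  (forall u, same_measure (pushforward muY (fun y => Q2 (u, y))) muY) ->
  reversible_simulator muX muY muUF kF kU (Pinv \o S \o Q) (Qinv \o R \o P).
Proof.
move=> [[mS mR SK RK] condF condU pushS pushR] PE QE iP iQ P1E Q2E.
have [mP mPinv PK PinvK] := iP; have [mQ mQinv QK QinvK] := iQ.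
(* Write [z] as [P (Pinv z)]: [P] keeps the second coordinate. *)
have Pinv2 z : (Pinv z).2 = z.2.
  by rewrite -{2}(PinvK z); case: (Pinv z) => x f; rewrite PE.
have Qinv1 z : (Qinv z).1 = z.1.
  by rewrite -{2}(QinvK z); case: (Qinv z) => u y; rewrite QE.
have pushP := same_measure_pushforward_fiber1 (marginal2 muUF) mP PE P1E.
have pushQ := same_measure_pushforward_fiber2 (marginal1 muUF) QE Q2E.
split.
- split; last 2 first.
  + exact: can_comp (can_comp PinvK SK) QK.
  + exact: can_comp (can_comp QinvK RK) PK.
  + by do 2!apply: measurableT_comp => //.
  + by do 2!apply: measurableT_comp => //.
(* The exceptional null set is that of [S], since [Q] keeps [u] and [Q2E] holds at every [u].
   Invariance under [Q2 (u, _)] is applied to the preimage of [A] under the second component of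
   [S (u, _)], whose measurability is the remaining goal. *)
- apply: filterS condF => u SE A mA; rewrite -SE// -[RHS](Q2E u).
    by congr (muY _); apply/seteqP; split=> y /=; rewrite Pinv2 QE.
  rewrite -[_ @^-1` _]setTI.
  have mSu : measurable_fun setT (fun y => (S (u, y)).2).
    by apply: measurableT_comp => //; apply: measurableT_comp.
  exact: mSu.
- apply: filterS condU => f RE A mA; rewrite -RE// -[RHS](P1E f).
    by congr (muX _); apply/seteqP; split=> x /=; rewrite Qinv1 PE.
  rewrite -[_ @^-1` _]setTI.
  have mRf : measurable_fun setT (fun x => (R (x, f)).1).
    by apply: measurableT_comp => //; apply: measurableT_comp.
  exact: mRf.
(* [Q] fixes the product of [marginal1 muUF] and [muY], [S] carries it to that of [muX] and
   [marginal2 muUF], and [Pinv] fixes the latter. *)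
- apply: same_measure_pushforward_comp pushQ _; first exact: measurableT_comp.
  apply: same_measure_pushforward_comp pushS _ => //.
  exact: same_measure_pushforward_inv pushP.
(* The same chain in the opposite direction, through [P], [R] and [Qinv]. *)
- apply: same_measure_pushforward_comp pushP _; first exact: measurableT_comp.
  apply: same_measure_pushforward_comp pushR _ => //.
  exact: same_measure_pushforward_inv pushQ.
Qed.

End product.

Theorem lemma3p6 (K : realType) (n m : nat)
    (muX : probability (Rn K n) K) (muY : probability (Rn K m) K)
    (muUF : probability (Rn K n * Rn K m)%type K)
    (kF : K.-pker (Rn K n) ~> (Rn K m)) (kU : K.-pker (Rn K m) ~> (Rn K n))
    (S R : Rn K n * Rn K m -> Rn K n * Rn K m)
    (P1 : Rn K n * Rn K m -> Rn K n) (Q2 : Rn K n * Rn K m -> Rn K m)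
    (P Pinv Q Qinv : Rn K n * Rn K m -> Rn K n * Rn K m) :
  disintegration1 muUF kF ->
  disintegration2 muUF kU ->
  reversible_simulator muX muY muUF kF kU S R ->
  (forall x f, P (x, f) = (P1 (x, f), f)) ->
  (forall u y, Q (u, y) = (u, Q2 (u, y))) ->
  borel_inverse P Pinv ->
  borel_inverse Q Qinv ->
  (forall f : Rn K m, same_measure (pushforward muX (fun x => P1 (x, f))) muX) ->
  (forall u : Rn K n, same_measure (pushforward muY (fun y => Q2 (u, y))) muY) ->
  reversible_simulator muX muY muUF kF kU (Pinv \o S \o Q) (Qinv \o R \o P).
Proof.
move=> _ _ simS PE QE iP iQ P1E Q2E.
exact: reversible_simulator_comp simS PE QE iP iQ P1E Q2E.
Qed.
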